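(* Let $K,K'$ be two separably closed fields of characteristic $p,p'$ respectively. If the Golomb spaces $G(K[X])$ and $G(K'[X])$ are homeomorphic, then $p=p'$.
   Context: For an integral domain $R$ that is not a field, put $R^\bullet := R\setminus\{0\}$. The Golomb space $G(R)$ is the set $R^\bullet$ with the topology generated by the coprime cosets of $R$, i.e. by the sets $x+I$ (as subsets of $R^\bullet$, i.e. $(x+I)\cap R^\bullet$) where $x\in R^\bullet$, $I$ is a nonzero ideal of $R$, and $\langle x, I\rangle = R$. Characteristics are allowed to be $0$. *)

(* Defs.v *)
From HB Require Import structures.
From mathcomp Require Import all_boot all_order all_algebra.
From mathcomp Require Import separable.
From mathcomp Require Import all_classical.
From mathcomp Require Import topology.
Set Implicit Arguments.
Unset Strict Implicit.
Unset Printing Implicit Defensive.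
Import GRing.Theory.
Local Open Scope ring_scope.
Local Open Scope classical_set_scope.

(* The library's proper_ideal and idealr_closed exclude the unit ideal, which
   is allowed as the ideal of a coset; hence this definition. *)
Definition is_ideal (R : comNzRingType) (I : set R) : Prop :=
  [/\ I 0, forall a b, I a -> I b -> I (a + b) & forall r a, I a -> I (r * a)].

Definition ideal_span (R : comNzRingType) (A : set R) : set R :=
  smallest (@is_ideal R) A.

Definition golomb (R : idomainType) : Type := {x : R | x != 0}.

HB.instance Definition _ (R : idomainType) := Choice.on (golomb R).

(* (x + I) \ {0}, as a subset of R \ {0} *)
Definition golomb_coset (R : idomainType) (x : golomb R) (I : set R) :
    set (golomb R) :=
  [set y | exists2 i, I i & val y = val x + i].

Definition coprime_cosets (R : idomainType) : set_system (golomb R) :=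
  [set U | exists (x : golomb R) (I : set R),
     [/\ is_ideal I, I != [set 0], ideal_span (val x |` I) = setT
       & U = golomb_coset x I]].

HB.instance Definition _ (R : idomainType) :=
  isSubBaseTopological.Build (golomb R) (@coprime_cosets R) id.

Definition homeomorphic (S T : topologicalType) : Prop :=
  exists (f : S -> T) (g : T -> S),
    [/\ cancel f g, cancel g f, continuous f & continuous g].

(* separable_poly p means that p is coprime to its derivative. *)
Definition separably_closed (K : fieldType) : Prop :=
  forall p : {poly K}, separable_poly p -> (1 < size p)%N ->
    exists x : K, root p x.

(* [pchar R] only contains primes: characteristic 0 means that it is empty. *)
Definition has_characteristic (R : nzRingType) (p : nat) : Prop :=
  if p is 0 then [pchar R] =i pred0 else p \in [pchar R].

(* Main.v *)
Require Import Defs.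
From mathcomp Require Import all_boot all_algebra all_classical topology.
From mathcomp Require Import separable cyclotomic ring zify.

(** The invariant is a set of integers, the "link numbers", defined from the
    topology alone.  In [G(K[X])] the closure of [y + (f)] consists of the [w]
    congruent to [y] modulo the largest divisor of [f] coprime to [w]; this
    makes "every irreducible factor of x divides y" a topological relation.
    Hence so are the units, the set [E_x] of elements with the same
    irreducible factors as [x], and, through the clopen subsets of
    [{y | y coprime to P}], the [P]-adic topology.

    For [x] irreducible, nonunits [P], [Q] and a unit [u], consider the units
    [v] such that some elements of [E_x] are simultaneously [P]-adically close
    to [u] and [Q]-adically close to [v].  In characteristic 0 there are none,
    because a power of [X - a] is never close to a constant modulo the square
    of another prime.  In characteristic [p] the [v / u] are closed under
    multiplication, so if there are [e] of them each satisfies [r ^ e = 1], and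
    [e = p] is impossible; on the other hand every prime [e <> p] occurs, for
    [x = X], [P = X - 1], [Q = X - z] with [z] a primitive [e]-th root of unity,
    where the powers [X ^ (m p^k)] realise exactly [v / u = z ^ i]. *)

Set Implicit Arguments.
Unset Strict Implicit.
Unset Printing Implicit Defensive.
Import GRing.Theory.
Local Open Scope ring_scope.
Local Open Scope classical_set_scope.

(** * Invariants of a topological space *)

Section TopologicalInvariants.
Variable T : topologicalType.
Implicit Types (x y z u v P Q : T) (U V W : set T).

(* In a Golomb space: every irreducible factor of [x] divides [y], see
   [supp_leP].  The auxiliary [z] can be taken to be any unit. *)
Definition supp_le x y := exists z, [/\ z <> x, z <> y &
  forall U, nbhs y U -> exists V W,
    [/\ nbhs x V, nbhs z W & closure V `&` closure W `<=` closure U]].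

Definition supp_empty x := forall y, supp_le x y.

Definition supp_disj x y :=
  forall z, supp_le z x -> supp_le z y -> supp_empty z.

(** In a Golomb space these are the powers of a single irreducible polynomial, up to units:
    irreducibility itself is not visible, only the set of irreducible factors is. *)
Definition supp_atom x :=
  ~ supp_empty x /\ forall y, supp_le y x -> supp_empty y \/ supp_le x y.

(* [V] is a relatively clopen subset of the elements coprime to [P]; these
   sets are a base of the [P]-adic topology. *)
Definition clopen_off P V :=
  [/\ open V, open (supp_disj P `\` V) & V `<=` supp_disj P].

Definition linked x P Q u v := forall V W, clopen_off P V -> clopen_off Q W ->
  V u -> W v -> exists y, [/\ supp_le x y, supp_le y x, V y & W y].

(** The injection [s], whose image is the set of all linked units, says that there are exactly [e]
    of them. *)
Definition link_number (e : nat) := exists x P Q u (s : 'I_e -> T),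
  [/\ supp_atom x, ~ supp_empty P, ~ supp_empty Q, supp_empty u &
   injective s /\
   forall v, supp_empty v /\ linked x P Q u v <-> exists i, s i = v].

End TopologicalInvariants.

(** * Invariance under homeomorphisms *)

Definition homeo_pair (S T : topologicalType) (f : S -> T) (g : T -> S) :=
  [/\ cancel f g, cancel g f, continuous f & continuous g].

Lemma homeo_pairC (S T : topologicalType) (f : S -> T) (g : T -> S) :
  homeo_pair f g -> homeo_pair g f.
Proof. by case. Qed.

Lemma nbhs_homeo (S T : topologicalType) (f : S -> T) (g : T -> S) x A :
  homeo_pair f g -> nbhs x A -> nbhs (f x) (g @^-1` A).
Proof. by move=> [fK gK _ g_cont] xA; apply: g_cont; rewrite fK. Qed.

Lemma closure_homeo (S T : topologicalType) (f : S -> T) (g : T -> S) A :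
  homeo_pair f g -> closure (g @^-1` A) = g @^-1` closure A.
Proof.
move=> fg; have [fK gK f_cont g_cont] := fg.
apply/seteqP; split=> y cl B yB.
  have [|z [Az Bz]] := cl (g @^-1` B); first exact: g_cont.
  by exists (g z).
have [|z [Az Bz]] := cl (f @^-1` B); first by apply: f_cont; rewrite gK.
by exists (f z); rewrite /= /preimage /= fK.
Qed.

Lemma supp_le_homeo (S T : topologicalType) (f : S -> T) (g : T -> S) x y :
  homeo_pair f g -> supp_le (f x) (f y) = supp_le x y.
Proof.
move=> fg.
(* Stated for all pairs of spaces, so that it also applies to the inverse map. *)
have main (S' T' : topologicalType) (f' : S' -> T') (g' : T' -> S') x' y' :
    homeo_pair f' g' -> supp_le x' y' -> supp_le (f' x') (f' y').
  move=> fg' [z [zx zy le]]; have [fK gK f_cont g_cont] := fg'.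
  exists (f' z); split; [by move/(can_inj fK)|by move/(can_inj fK)|].
  move=> U yU; have [|V [W [xV zW sub]]] := le (f' @^-1` U).
    exact: f_cont.
  exists (g' @^-1` V), (g' @^-1` W); split; try exact: nbhs_homeo.
  rewrite !(closure_homeo _ fg') => w [/= Vw Ww].
  have := sub (g' w) (conj Vw Ww).
  by rewrite (closure_homeo _ (homeo_pairC fg')) /= gK.
apply: propext; split; last exact: (main _ _ _ _ _ _ fg).
by move/(main _ _ _ _ _ _ (homeo_pairC fg)); case: fg => fK _ _ _; rewrite !fK.
Qed.

Section Transport.
Variables (S T : topologicalType) (f : S -> T) (g : T -> S).
Hypothesis fg : homeo_pair f g.

Lemma supp_empty_homeo x : supp_empty (f x) = supp_empty x.
Proof.
case: (fg) => _ gK _ _; apply: propext; split=> H y.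
  by rewrite -(supp_le_homeo _ _ fg).
by rewrite -(gK y) (supp_le_homeo _ _ fg).
Qed.

Lemma supp_disj_homeo x y : supp_disj (f x) (f y) = supp_disj x y.
Proof.
case: (fg) => _ gK _ _; apply: propext; split=> H z.
  by rewrite -!(supp_le_homeo _ _ fg) -supp_empty_homeo; apply: H.
rewrite -(gK z) !(supp_le_homeo _ _ fg) supp_empty_homeo; exact: H.
Qed.

Lemma supp_atom_homeo x : supp_atom (f x) = supp_atom x.
Proof.
case: (fg) => _ gK _ _; rewrite /supp_atom supp_empty_homeo.
apply: propext; split=> -[H0 H]; split=> // y.
  by rewrite -!(supp_le_homeo _ _ fg) -supp_empty_homeo; apply: H.
rewrite -(gK y) !(supp_le_homeo _ _ fg) supp_empty_homeo; exact: H.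
Qed.

Lemma clopen_off_homeo P V : clopen_off (f P) V -> clopen_off P (f @^-1` V).
Proof.
case: (fg) => fK gK f_cont g_cont [oV oCV sV]; split.
- by move/continuousP: f_cont; apply.
- have -> : supp_disj P `\` f @^-1` V = f @^-1` (supp_disj (f P) `\` V).
    by apply/seteqP; split=> y [/= dy Vy]; split=> //; move: dy; rewrite supp_disj_homeo.
  by move/continuousP: f_cont; apply.
- by move=> y /sV; rewrite supp_disj_homeo.
Qed.

Lemma linked_homeo x P Q u v :
  linked x P Q u v -> linked (f x) (f P) (f Q) (f u) (f v).
Proof.
move=> l V W /clopen_off_homeo cV /clopen_off_homeo cW Vu Wv.
have [y [xy yx Vy Wy]] := l _ _ cV cW Vu Wv.
by exists (f y); rewrite !(supp_le_homeo _ _ fg).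
Qed.

End Transport.

Lemma link_number_homeo (S T : topologicalType) e :
  homeomorphic S T -> link_number S e -> link_number T e.
Proof.
move=> [f [g fg]] [x [P [Q [u [s [ax nP nQ eu [sI sE]]]]]]].
have gf : homeo_pair g f by exact: homeo_pairC.
case: (fg) => fK gK _ _.
exists (f x), (f P), (f Q), (f u), (f \o s).
split; rewrite ?(supp_atom_homeo fg) ?(supp_empty_homeo fg) //.
split; first by apply: inj_comp => //; apply: can_inj fK.
move=> v; split.
  move=> [ev lv]; have [|i iv] := (sE (g v)).1.
    split; first by rewrite (supp_empty_homeo gf).
    by have := linked_homeo gf lv; rewrite !fK.
  by exists i; rewrite /= iv gK.
move=> [i <-]; have [ei li] := (sE (s i)).2 (ex_intro _ i erefl).
by rewrite /= (supp_empty_homeo fg); split=> //; apply: (linked_homeo fg).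
Qed.

(** * The Golomb space of K[X] *)

Lemma ideal_span_setU1 (R : comNzRingType) (x : R) (I : set R) y :
  is_ideal I -> ideal_span (x |` I) y -> exists r i, I i /\ y = r * x + i.
Proof.
move=> [I0 ID IM] /(_ [set y | exists r i, I i /\ y = r * x + i]); apply.
split; first split.
- by exists 0, 0; rewrite mul0r addr0.
- move=> _ _ [r [i [Ii ->]]] [s [j [Ij ->]]]; exists (r + s), (i + j).
  by split; [exact: ID | ring].
- move=> s _ [r [i [Ii ->]]]; exists (s * r), (s * i).
  by split; [exact: IM | ring].
- move=> z [->|Iz]; first by exists 1, 0; rewrite mul1r addr0.
  by exists 0, z; rewrite mul0r add0r.
Qed.

Section GolombPoly.
Variable K : fieldType.
Implicit Types (x y z u v : golomb {poly K}) (a b d f g p q : {poly K}).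

(** Bezout gives a solution [w], but a point of the Golomb space must be nonzero; when [w] vanishes,
    [a * b] is a nonzero solution. *)
Lemma chinese_poly a b s t : coprimep a b -> a != 0 -> b != 0 ->
  exists v, (a %| val v - s) /\ (b %| val v - t).
Proof.
move=> /Bezout_eq1_coprimepP [[/= m n] mn] a0 b0.
pose w := m * a * t + n * b * s.
have wP c : (a %| w + c * (a * b) - s) /\ (b %| w + c * (a * b) - t).
  have -> : w + c * (a * b) - s = a * (m * (t - s) + c * b).
    by rewrite -[s in LHS]mul1r -mn /w; ring.
  have -> : w + c * (a * b) - t = b * (n * (s - t) + c * a).
    by rewrite -[t in LHS]mul1r -mn /w; ring.
  by rewrite !dvdp_mulr.
have ab0 : a * b != 0 by rewrite mulf_neq0.
have [w0|w0] := eqVneq w 0.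
  exists (exist _ (a * b) ab0) => /=.
  by have := wP 1; rewrite w0 mul1r add0r.
by exists (exist _ w w0); have := wP 0; rewrite mul0r addr0.
Qed.

Lemma coprime_cosets_nbhd U y : coprime_cosets U -> U y ->
  exists f, [/\ f != 0, coprimep (val y) f
    & forall z, f %| val z - val y -> U z].
Proof.
move=> [x [I [idI I0 xI ->]]] [i Ii yE].
have [|r [j [Ij e1]]] := @ideal_span_setU1 _ (val x) I 1 idI; first by rewrite xI.
have [IZ ID IM] := idI.
have IB a b : I a -> I b -> I (a - b).
  by move=> Ia Ib; apply: ID => //; rewrite -mulN1r; apply: IM.
suff [f [f0 If cyf]] : exists f, [/\ f != 0, I f & coprimep (val y) f].
  exists f; split=> // z /dvdpP [c zE].
  exists (i + c * f); first by apply: ID => //; apply: IM.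
  by rewrite addrA -yE -zE; ring.
have e2 : r * val y + (j - r * i) = 1 by rewrite yE e1; ring.
(* The element [j - r * i] of [I] is coprime to [y] by [e2]. If it is zero, [y] is a unit and any
   nonzero element of [I] serves. *)
have [e0|ne0] := eqVneq (j - r * i) 0.
  have [f [If f0]] : exists f, I f /\ f != 0.
    apply/not_existsP => no; move/eqP: I0; apply.
    apply/seteqP; split=> [f If|_ ->] //; have := no f.
    by apply: contra_notP => /eqP.
  exists f; split=> //; apply/Bezout_eq1_coprimepP.
  by exists (r, 0); rewrite -e2 e0 mul0r.
exists (j - r * i); split=> //; first by apply: IB => //; apply: IM.
by apply/Bezout_eq1_coprimepP; exists (r, 1); rewrite mul1r.
Qed.

(** Neighbourhoods given by principal ideals only, and by cosets centred at [y] itself;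
    [golomb_nbhsE] identifies them with those of the Golomb topology. *)
Definition coset_nbhs y : set_system (golomb {poly K}) :=
  [set A | exists f, [/\ f != 0, coprimep (val y) f
    & forall z, f %| val z - val y -> A z]].

#[local] Instance coset_nbhs_filter y : Filter (coset_nbhs y).
Proof.
split.
- by exists 1; rewrite oner_neq0 coprimep1.
- move=> A B [f [f0 cf fA]] [g [g0 cg gB]]; exists (f * g).
  rewrite mulf_neq0 // coprimepMr cf cg; split=> // z fgz.
  split; [apply: fA | apply: gB]; apply: dvdp_trans fgz;
    by rewrite ?dvdp_mulIl ?dvdp_mulIr.
- by move=> A B sAB [f [f0 cf fA]]; exists f; split=> // z /fA /sAB.
Qed.

Lemma golomb_nbhsE y : nbhs y = coset_nbhs y.
Proof.
apply/seteqP; split=> A.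
  rewrite nbhsE => -[B [oB By] sBA]; apply: filterS sBA _.
  case: oB By => D sD <- [V /[dup] /sD [F sF FV] DV Vy].
  apply: (@filterS _ _ _ V) => [z Vz|]; first by exists V.
  rewrite -FV; apply: filter_bigI => U UF.
  apply: coprime_cosets_nbhd; first by have := sF _ UF; rewrite inE.
  by move: Vy; rewrite -FV; apply.
move=> [f [f0 cyf sfA]]; rewrite nbhsE.
have fdvdB : is_ideal [set i | f %| i].
  split=> [|a b|r a] /=; [exact: dvdp0|exact: dvdp_add|exact: dvdp_mull].
exists (golomb_coset y [set i | f %| i]); last first.
  by move=> z [i fi zE]; apply: sfA; rewrite [val z]zE addrAC subrr add0r.
split; last by exists 0; rewrite /= ?dvdp0 ?addr0.
have cU : coprime_cosets (golomb_coset y [set i | f %| i]).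
  exists y, [set i | f %| i]; split=> //.
    by apply/eqP => /seteqP[/(_ f (dvdpp f)) /= f0' _]; rewrite f0' eqxx in f0.
  apply/seteqP; split=> // t _ J [[J0 JD JM] sJ].
  have /Bezout_eq1_coprimepP [[/= m n] mn] := cyf.
  rewrite -[t]mulr1 -mn; apply: (JM); apply: (JD); apply: (JM).
    by apply: sJ; left.
  by apply: sJ; right => /=.
exists [set golomb_coset y [set i | f %| i]]; last by rewrite bigcup_set1.
by move=> _ ->; apply: (@finI_from1 _ _ _ id).
Qed.

End GolombPoly.

(** * Irreducible factors and coprime parts of polynomials *)

Section PolyFactor.
Variable K : fieldType.
Implicit Types (a b d f g p q : {poly K}).

Lemma irredp_factor p : p != 0 -> size p != 1%N ->
  exists2 q, irreducible_poly q & q %| p.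
Proof.
have [n] := ubnP (size p); elim: n => // n IHn in p *.
rewrite ltnS => le_pn p0 p1.
have [irr_p|] := pselect (irreducible_poly p); first by exists p.
move=> redp; have [d [d1 dp ndp]] : exists d, [/\ size d != 1%N, d %| p & ~~ (d %= p)].
  apply/not_existsP => nod; apply: redp; split.
    by rewrite ltn_neqAle eq_sym p1 size_poly_gt0.
  by move=> d d1 dp; apply/negPn/negP => ndp; apply: (nod d).
have d0 : d != 0 by apply: contraNneq p0 => d0; rewrite -dvd0p -d0.
have [|//|//|q irr_q qd] := IHn d.
  apply: leq_trans le_pn; rewrite ltn_neqAle dvdp_leq // andbT.
  by rewrite dvdp_size_eqp.
by exists q => //; apply: dvdp_trans dp.
Qed.

Lemma ncoprimep_irredp a b : a != 0 -> ~~ coprimep a b ->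
  exists q, [/\ irreducible_poly q, q %| a & q %| b].
Proof.
move=> a0 nab; have [|//|q irr_q] := @irredp_factor (gcdp a b).
  by rewrite gcdp_eq0 (negPf a0).
by rewrite dvdp_gcd => /andP[qa qb]; exists q.
Qed.

Lemma irredp_dvdpM q a b : irreducible_poly q ->
  (q %| a * b) = (q %| a) || (q %| b).
Proof.
move=> irr_q; have [qa|nqa] := boolP (q %| a); first by rewrite dvdp_mulr.
by rewrite Gauss_dvdpr // irreducible_poly_coprime.
Qed.

(** Irreducible factors shared with [w] are moved from [f] into [b] one at a time, each raising [k]
    by one, until the rest is prime to [w]. *)
Lemma coprime_split f w : f != 0 -> exists a b k,
  [/\ f = a * b, coprimep a w & b %| w ^+ k].
Proof.
have [n] := ubnP (size f); elim: n => // n IHn in f *.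
rewrite ltnS => le_fn f0.
have [cfw|/(ncoprimep_irredp f0)[q [irr_q qf qw]]] := boolP (coprimep f w).
  by exists f, 1, 0%N; rewrite mulr1.
pose g := f %/ q; have fE : f = g * q by rewrite divpK.
have g0 : g != 0 by apply: contraNneq f0 => g0; rewrite fE g0 mul0r.
have [|//|a [b [k [gE caw bw]]]] := IHn g.
  apply: leq_trans le_fn; rewrite fE size_mul // ?irredp_neq0 //.
  have lt m l : (0 < m)%N -> (1 < l)%N -> (m < (m + l).-1)%N by lia.
  by apply: lt; [rewrite size_poly_gt0 | case: irr_q].
exists a, (b * q), k.+1; split=> //; first by rewrite fE gE mulrA.
by rewrite exprSr dvdp_mul.
Qed.

Lemma size_exp_gt p n : (1 < size p)%N -> (n < size (p ^+ n))%N.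
Proof.
move=> p1; have p0 : p != 0 by rewrite -size_poly_gt0 ltnW.
have := size_exp p n; rewrite [size (p ^+ n)]polySpred ?expf_neq0 //= => ->.
by rewrite ltnS -{1}[n]mul1n leq_mul2r -ltnS -polySpred // p1 orbT.
Qed.

Lemma ndvdp_exp_size q a n : (1 < size q)%N -> a != 0 -> (size a <= n)%N ->
  ~~ (q ^+ n %| a).
Proof.
move=> q1 a0 an; apply: contraTN (size_exp_gt n q1) => /(dvdp_leq a0) le.
by rewrite -leqNgt (leq_trans le).
Qed.

End PolyFactor.

(** * Closures of congruence classes, and divisibility read off the topology *)

Section GolombPoly.
Variable K : fieldType.
Implicit Types (x y z u v w P Q : golomb {poly K}) (a b d f g p q : {poly K}).

Definition cong_class y f : set (golomb {poly K}) :=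
  [set z | f %| val z - val y].

Lemma nbhs_cong_class y f : f != 0 -> coprimep (val y) f ->
  nbhs y (cong_class y f).
Proof. by move=> f0 cyf; rewrite golomb_nbhsE; exists f. Qed.

Lemma nbhs_cong_sub y A : nbhs y A ->
  exists f, [/\ f != 0, coprimep (val y) f & cong_class y f `<=` A].
Proof. by rewrite golomb_nbhsE => -[f [f0 cyf sA]]; exists f. Qed.

(** As [d] is prime to [w], the class of [w] modulo [d] is a neighbourhood of [w], hence meets that
    of [y] modulo [f]. *)
Lemma closure_cong_dvd y f w d : closure (cong_class y f) w ->
  d != 0 -> coprimep (val w) d -> d %| f -> d %| val w - val y.
Proof.
move=> clw d0 cwd df; have [v [/= fv dv]] := clw _ (nbhs_cong_class d0 cwd).
have -> : val w - val y = (val v - val y) - (val v - val w) by ring.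
by rewrite dvdp_sub // (dvdp_trans df).
Qed.

(** A basic neighbourhood of [w] has a modulus [f] prime to [w], hence to [b], so the congruences to
    [w] modulo [a * f] and to [y] modulo [b] are compatible. *)
Lemma closure_cong_mem y a b k w : a * b != 0 -> coprimep a b ->
  a %| val w - val y -> b %| val w ^+ k -> closure (cong_class y (a * b)) w.
Proof.
rewrite mulf_eq0 negb_or => /andP[a0 b0] cab aw bw B /nbhs_cong_sub[f [f0 cwf sB]].
have cfb : coprimep f b.
  rewrite coprimep_sym; apply: coprimep_dvdr bw _.
  exact: coprimep_expl.
have [|||v [afv bv]] := @chinese_poly K (a * f) b (val w) (val y) => //.
- by rewrite coprimepMl cab.
- by rewrite mulf_neq0.
exists v; split; last by apply/sB/(dvdp_trans _ afv)/dvdp_mull.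
rewrite /cong_class /= Gauss_dvdp // bv andbT.
have -> : val v - val y = (val v - val w) + (val w - val y) by ring.
by rewrite dvdp_add // (dvdp_trans _ afv) // dvdp_mulr.
Qed.

Lemma polyC_neq0 (c : K) : c != 0 -> c%:P != 0.
Proof. by rewrite polyC_eq0. Qed.

Definition to_golomb f (f0 : f != 0) : golomb {poly K} := exist _ f f0.

Definition unit_golomb (c : K) (c0 : c != 0) := to_golomb (polyC_neq0 c0).

Lemma unit_golombP x : size (val x) = 1%N ->
  exists c (c0 : c != 0), x = unit_golomb c0.
Proof.
by move=> /eqP/size_poly1P[c c0 xE]; exists c, c0; apply: val_inj.
Qed.

Lemma coprimep_unit p q : size p = 1%N -> coprimep p q.
Proof.
move=> /eqP p1; rewrite size_poly_eq1 in p1.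
by rewrite (eqp_coprimepl _ p1) coprime1p.
Qed.

Hypothesis three_units : exists c : K, [/\ c != 0, c != 1 & c ^+ 2 != 1].

(** Of the three distinct units 1, [c] and [c ^+ 2], at least one differs from both points. *)
Lemma unit_avoid x y : exists z, [/\ z <> x, z <> y & size (val z) = 1%N].
Proof.
have [c [c0 c1 c2]] := three_units.
pose U n := unit_golomb (expf_neq0 n c0).
have UI i j : c ^+ i != c ^+ j -> U i <> U j.
  by move=> ne /(congr1 val) /= /polyC_inj /eqP; apply/negP.
have sU i : size (val (U i)) = 1%N by rewrite size_polyC expf_neq0.
have U01 : U 0%N <> U 1%N by apply: UI; rewrite eq_sym.
have U02 : U 0%N <> U 2%N by apply: UI; rewrite eq_sym.
have U12 : U 1%N <> U 2%N.
  by apply: UI; rewrite expr1 -[X in X != _]mulr1 expr2 (inj_eq (mulfI c0)) eq_sym.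
apply: contrapT => no.
have inU i : U i = x \/ U i = y.
  apply: contrapT => /not_orP[Ux Uy]; apply: no; by exists (U i).
have [] := (inU 0%N, inU 1%N, inU 2%N).
by move=> [[E0|E0] [E1|E1]] [E2|E2]; congruence.
Qed.

Lemma supp_leP x y : supp_le x y <->
  forall q, irreducible_poly q -> q %| val x -> q %| val y.
Proof.
split=> [[z [zx zy le]] q irr_q qx|le].
  apply/negPn/negP => nqy.
  have cqE a : coprimep q a = ~~ (q %| a) by exact: irreducible_poly_coprime.
  have q0 := irredp_neq0 irr_q.
  (* The size alone prevents [q ^+ n] from dividing [z - y]; the successor ensures that [n] is
     positive, so that [q] divides [q ^+ n]. *)
  pose n := (size (val z - val y)).+1.
  have nqn : ~~ (q ^+ n %| val z - val y).
    apply: ndvdp_exp_size => //; first exact: irr_q.1.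
    by rewrite subr_eq0; apply/eqP => /val_inj.
  have qn0 m : q ^+ m != 0 by rewrite expf_neq0.
  have [|V [W [xV zW sVW]]] := le (cong_class y (q ^+ n)).
    by apply: nbhs_cong_class => //; apply: coprimep_expr; rewrite coprimep_sym cqE.
  have [f [f0 cxf sV]] := nbhs_cong_sub xV.
  have [g [g0 czg sW]] := nbhs_cong_sub zW.
  have cqf : coprimep q f by apply: coprimep_dvdr cxf.
  have not_both w : closure (cong_class x f) w -> closure (cong_class z g) w ->
      coprimep q (val w) -> q ^+ n %| val w - val y.
    move=> xw zw cqw; apply: closure_cong_dvd (dvdpp _) => //.
      by apply: sVW; split; [exact: closureS sV _ xw | exact: closureS sW _ zw].
    by rewrite coprimep_sym; apply: coprimep_expl.
  have fx w : f %| val w -> closure (cong_class x f) w.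
    move=> fw; rewrite -[f]mul1r; apply: (@closure_cong_mem _ _ _ 1);
      by rewrite ?mul1r ?coprime1p ?dvd1p.
  (* A multiple [w] of [f * g] prime to [q] lies in both closures; it is chosen
     [q]-adically far from [y], and [q]-adically close to [z] if that is forced
     by [q] being a factor of [g]. *)
  have [qz|nqz] := boolP (q %| val z).
    have cqg : coprimep q g by apply: coprimep_dvdr czg.
    have [c [c0 c1 _]] := three_units.
    (* Here [w] is near [c *: y] with [c] neither 0 nor 1: it is prime to [q], and [w] congruent to
       [y] would make [q] divide [(c - 1) *: y]. *)
    have [|||w [wq wfg]] := @chinese_poly K (q ^+ n) (f * g) (c *: val y) 0.
    - by apply: coprimep_expl; rewrite coprimepMr cqf.
    - exact: qn0.
    - by rewrite mulf_neq0.
    rewrite subr0 in wfg.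
    have cqw : coprimep q (val w).
      rewrite cqE; apply: contra nqy => qw.
      rewrite -(dvdpZr _ _ c0) -(dvdp_subr _ qw).
      by apply: dvdp_trans wq; rewrite dvdp_exp.
    have := not_both w (fx w (dvdp_trans (dvdp_mulIl _ _) wfg)) _ cqw.
    have gz : closure (cong_class z g) w.
      rewrite -[g]mul1r; apply: (@closure_cong_mem _ _ _ 1);
        rewrite ?mul1r ?coprime1p ?dvd1p //.
      exact: (dvdp_trans (dvdp_mulIr _ _) wfg).
    move=> /(_ gz) wy; move/negP: nqy; apply.
    have : q ^+ n %| (val w - val y) - (val w - c *: val y) by rewrite dvdp_sub.
    have -> : (val w - val y) - (val w - c *: val y) = (c - 1) *: val y.
      by rewrite scalerBl scale1r; ring.
    rewrite dvdpZr ?subr_eq0 //; apply: dvdp_trans; exact: dvdp_exp.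
  have [a [b [k [gE caq bq]]]] := coprime_split q g0.
  have [a0 b0] : a != 0 /\ b != 0 by apply/andP; rewrite -negb_or -mulf_eq0 -gE.
  (* The exponent covers both needs: [q ^+ k] is a multiple of the part [b] of [g], and [q ^+ n]
     turns [w] congruent to [y] into [z] congruent to [y]. *)
  have [|||w [wz wfa]] := @chinese_poly K (q ^+ (n + k)) (f * a) (val z) 0.
  - by apply: coprimep_expl; rewrite coprimepMr cqf coprimep_sym.
  - exact: qn0.
  - by rewrite mulf_neq0.
  rewrite subr0 in wfa.
  have wzE m : (m <= n + k)%N -> q ^+ m %| val w - val z.
    by move=> le_m; apply: dvdp_trans wz; rewrite dvdp_exp2l.
  have cqw : coprimep q (val w).
    rewrite cqE; apply: contra nqz => qw.
    by rewrite -(dvdp_subr _ qw); apply: (wzE 1%N); rewrite /n addSn.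
  have gz : closure (cong_class z g) w.
    rewrite gE mulrC; apply: (@closure_cong_mem _ _ _ 1).
    - by rewrite mulf_neq0.
    - by apply: coprimep_dvdr bq _; apply: coprimep_expl; rewrite coprimep_sym.
    - by apply: dvdp_trans bq _; apply: wzE; rewrite leq_addl.
    - exact: (dvdp_trans (dvdp_mulIr _ _) wfa).
  have wy := not_both w (fx w (dvdp_trans (dvdp_mulIl _ _) wfa)) gz cqw.
  move/negP: nqn; apply.
  have -> : val z - val y = (val w - val y) - (val w - val z) by ring.
  by rewrite dvdp_sub // wzE // leq_addr.
have [z [zx zy uz]] := unit_avoid x y.
exists z; split=> // U /nbhs_cong_sub[f [f0 cyf sU]].
have cxf : coprimep (val x) f.
  apply/negPn/negP => /ncoprimep_irredp[|q [irr_q qx qf]]; first exact: valP x.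
  have := coprimep_dvdr (le q irr_q qx) (coprimep_dvdl qf cyf).
  by rewrite coprimepp => /eqP q1; have := irr_q.1; rewrite q1.
(* No irreducible [q] satisfies [q ^+ n.+1 %| val x - val z]. *)
pose n := size (val x - val z).
have fn0 : f ^+ n.+1 != 0 by rewrite expf_neq0.
exists (cong_class x (f ^+ n.+1)), (cong_class z (f ^+ n.+1)); split.
- by apply: nbhs_cong_class => //; apply: coprimep_expr.
- by apply: nbhs_cong_class => //; apply: coprimep_unit.
move=> w [xw zw]; apply: closureS sU _ _.
have [a [b [k [fE caw bw]]]] := coprime_split (val w) f0.
have a0 : a != 0 by apply: contraNneq f0 => a0; rewrite fE a0 mul0r.
(* A factor of [f] not dividing [w] would make [x] and [z] congruent modulo its power [n.+1]. So [f]
   divides a power of [w], and [w] adheres to every class modulo [f]. *)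
have a1 : size a = 1%N.
  apply/eqP/negPn/negP => /(irredp_factor a0)[q irr_q qa].
  have cwq m : coprimep (val w) (q ^+ m).
    by apply: coprimep_expr; rewrite coprimep_sym; apply: coprimep_dvdr caw.
  have qf m : q ^+ m %| f ^+ m by rewrite dvdp_exp2r // fE dvdp_mulr.
  have q0 : q ^+ n.+1 != 0 by rewrite expf_neq0 // irredp_neq0.
  have wx := closure_cong_dvd xw q0 (cwq _) (qf _).
  have wz := closure_cong_dvd zw q0 (cwq _) (qf _).
  have : ~~ (q ^+ n.+1 %| val x - val z).
    apply: ndvdp_exp_size => //; first exact: irr_q.1.
    by rewrite subr_eq0; apply/eqP => /val_inj /esym.
  move/negP; apply.
  have -> : val x - val z = (val w - val z) - (val w - val x) by ring.
  by rewrite dvdp_sub.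
rewrite fE; apply: (@closure_cong_mem _ _ _ k) => //.
- by rewrite -fE.
- exact: coprimep_unit.
- by move/eqP: a1; rewrite size_poly_eq1 => /eqp_dvdl ->; rewrite dvd1p.
Qed.

Lemma irredp_golomb q : irreducible_poly q ->
  exists x, val x = q /\ size (val x) <> 1%N.
Proof.
move=> irr_q; exists (to_golomb (irredp_neq0 irr_q)); split=> //= q1.
by have := irr_q.1; rewrite q1.
Qed.

Lemma supp_emptyP x : supp_empty x <-> size (val x) = 1%N.
Proof.
split=> [e|x1 y]; last first.
  apply/supp_leP => q irr_q qx; have := coprimep_dvdr qx (coprimep_unit q x1).
  by rewrite coprimepp => /eqP q1; have := irr_q.1; rewrite q1.
apply/eqP/negPn/negP => /(irredp_factor (valP x))[q irr_q qx].
have := e (unit_golomb (oner_neq0 K)); move/supp_leP => /(_ q irr_q qx) /= q1.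
by have := irr_q.1; have := dvdp_leq (oner_neq0 _) q1; rewrite size_poly1 leqNgt => /negP.
Qed.

Lemma supp_disjP x y : supp_disj x y <-> coprimep (val x) (val y).
Proof.
split=> [dxy|cxy z /supp_leP zx /supp_leP zy].
  apply/negPn/negP => /(ncoprimep_irredp (valP x))[q [irr_q qx qy]].
  have [z [zq]] := irredp_golomb irr_q; apply; apply/supp_emptyP.
  by apply: dxy; apply/supp_leP => r irr_r; rewrite zq => rq; apply: dvdp_trans rq _.
apply/supp_emptyP/eqP/negPn/negP => /(irredp_factor (valP z))[q irr_q qz].
have := coprimep_dvdr (zx q irr_q qz) (coprimep_dvdl (zy q irr_q qz) cxy).
by rewrite coprimepp => /eqP q1; have := irr_q.1; rewrite q1.
Qed.

Lemma supp_atom_irredp q x : irreducible_poly q -> val x = q -> supp_atom x.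
Proof.
move=> irr_q xq; split=> [/supp_emptyP|y /supp_leP yx].
  by rewrite xq => q1; have := irr_q.1; rewrite q1.
have [y1|/(irredp_factor (valP y))[r irr_r ry]] := eqVneq (size (val y)) 1%N.
  by left; apply/supp_emptyP.
right; apply/supp_leP => s irr_s; rewrite xq => sq.
have rq : r %| q by rewrite -xq; apply: yx.
have sz1 (t : {poly K}) : irreducible_poly t -> size t != 1%N.
  by move=> [t1 _]; rewrite gtn_eqF.
have rEq := irr_q _ (sz1 _ irr_r) rq; have sEq := irr_q _ (sz1 _ irr_s) sq.
by rewrite (eqp_dvdl _ sEq) -(eqp_dvdl _ rEq).
Qed.

Lemma cong_coprimep p k a b : p ^+ k.+1 %| a - b -> coprimep p b -> coprimep p a.
Proof.
move=> /(dvdp_trans (dvdp_exp (ltn0Sn k) (dvdpp p))) /dvdpP[r].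
by move/eqP; rewrite subr_eq => /eqP -> ?; rewrite coprimep_addl_mul.
Qed.

(** The classes modulo [P ^+ k.+1] of elements prime to [P] are open and partition these elements,
    so each is relatively clopen. *)
Lemma clopen_off_cong P u k : coprimep (val P) (val u) ->
  clopen_off P (cong_class u (val P ^+ k.+1)).
Proof.
move=> cPu; set V := cong_class _ _.
have P0 : val P ^+ k.+1 != 0 by rewrite expf_neq0 // (valP P).
have sV : V `<=` supp_disj P by move=> z Vz; apply/supp_disjP/(cong_coprimep Vz).
have cong_nbhs z : supp_disj P z -> nbhs z (cong_class z (val P ^+ k.+1)).
  move=> /supp_disjP cPz; apply: nbhs_cong_class => //.
  by apply: coprimep_expr; rewrite coprimep_sym.
split=> //; rewrite openE => z.
  move=> /[dup] /sV /cong_nbhs + Vz; apply: filterS => t; rewrite /V /cong_class /=.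
  have -> : val t - val u = (val t - val z) + (val z - val u) by ring.
  by move/dvdp_addr ->.
move=> [Pz Vz]; apply: filterS (cong_nbhs z Pz) => t tz; split.
  by apply/supp_disjP/(cong_coprimep tz)/supp_disjP.
apply: contra_not Vz; rewrite /V /cong_class /= => tu.
have -> : val z - val u = (val t - val u) - (val t - val z) by ring.
exact: dvdp_sub.
Qed.

Lemma cong_sub_clopen_off P V y : clopen_off P V -> V y ->
  exists k, cong_class y (val P ^+ k.+1) `<=` V.
Proof.
move=> [oV oCV sV] Vy.
have [f [f0 cyf sfV]] := nbhs_cong_sub (open_nbhs_nbhs (conj oV Vy)).
have [f2 [f1 [k [fE cf2 f1P]]]] := coprime_split (val P) f0.
(* If [z] were outside [V], some [w] congruent to [z] and divisible by the parts
   of the two moduli prime to [P] would adhere to both [V] and its complement. *)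
exists k => z zy; apply: contrapT => nVz.
have cPz : coprimep (val P) (val z).
  by apply: cong_coprimep zy _; apply/supp_disjP/sV.
have Oz : (supp_disj P `\` V) z by split=> //; apply/supp_disjP.
have [g [g0 czg sgO]] := nbhs_cong_sub (open_nbhs_nbhs (conj oCV Oz)).
have [g2 [g1 [l [gE cg2 g1P]]]] := coprime_split (val P) g0.
have nz a b : a * b != 0 -> a != 0 by apply: contraNneq => ->; rewrite mul0r.
(* The exponent is at least [k] and [l], to handle [f1] and [g1], and positive, to keep [w] prime to
   [P]. *)
have [|||w [wP]] := @chinese_poly K (val P ^+ (k + l).+1) (f2 * g2) (val z) 0.
- by apply: coprimep_expl; rewrite coprimepMr !(coprimep_sym (val P)) cf2.
- by rewrite expf_neq0 // (valP P).
- by rewrite mulf_neq0 ?(nz f2 f1) ?(nz g2 g1) -?fE -?gE.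
rewrite subr0 => wfg.
have wPE m : (m <= (k + l).+1)%N -> val P ^+ m %| val w - val z.
  by move=> le_m; apply: dvdp_trans wP; rewrite dvdp_exp2l.
have cl t h h1 h2 m : h = h2 * h1 -> h != 0 -> coprimep h2 (val P) ->
    h1 %| val P ^+ m -> val P ^+ m %| val w - val t -> h2 %| val w ->
    closure (cong_class t h) w.
  move=> -> h0 ch h1P wt h2w; rewrite mulrC.
  apply: (@closure_cong_mem _ _ _ 1) => //; first by rewrite mulrC.
    by rewrite coprimep_sym; apply: coprimep_dvdl h1P _; apply: coprimep_expr.
  exact: dvdp_trans wt.
have Vw : closure V w.
  apply: closureS sfV _ _; apply: (cl _ _ f1 f2 k) => //.
    have -> : val w - val y = (val w - val z) + (val z - val y) by ring.
    rewrite dvdp_add ?wPE //; first by rewrite leqW // leq_addr.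
    by apply: dvdp_trans zy; rewrite dvdp_exp2l.
  exact: dvdp_trans (dvdp_mulIl _ _) wfg.
have Ow : closure (supp_disj P `\` V) w.
  apply: closureS sgO _ _; apply: (cl _ _ g1 g2 l) => //.
    by rewrite wPE // leqW // leq_addl.
  exact: dvdp_trans (dvdp_mulIr _ _) wfg.
have Pw : supp_disj P w.
  by apply/supp_disjP/(cong_coprimep wP).
have [VW|nVw] := pselect (V w).
  by have [v [[_ nVv] Vv]] := Ow V (open_nbhs_nbhs (conj oV VW)).
by have [v [Vv [_ nVv]]] := Vw _ (open_nbhs_nbhs (conj oCV (conj Pw nVw))).
Qed.

End GolombPoly.

(** * Separably closed fields *)

Lemma expr_pcharB (R : comNzRingType) p k (a b : R) : p \in [pchar R] ->
  (a - b) ^+ (p ^ k) = a ^+ (p ^ k) - b ^+ (p ^ k).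
Proof.
move=> pcharR; elim: k => [|k IHk]; first by rewrite !expr1.
rewrite expnSr !exprM IHk -!(pFrobenius_autE pcharR).
by rewrite pFrobenius_autB_comm //; apply: mulrC.
Qed.

Section SeparablyClosed.
Variable K : fieldType.
Hypothesis hK : separably_closed K.

(** The polynomial [X^e - 1] is separable, hence so is its cofactor [g] of [X - 1], and 1 is not a
    root of [g]. A root of [g] has order [e] because [e] is prime. *)
Lemma primitive_root_exists e : prime e -> e%:R != 0 :> K ->
  exists z : K, e.-primitive_root z.
Proof.
move=> pr_e e0; have sep := separable_Xn_sub_1 e0.
have [g gE] : exists g : {poly K}, 'X^e - 1 = g * ('X - 1%:P).
  by apply/dvdpP; rewrite dvdp_XsubCl /root !hornerE expr1n subrr.
move: (sep); rewrite gE separable_root => /andP[sep_g g1].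
have [|z gz] := hK sep_g.
  have : size (g * ('X - 1%:P)) = e.+1 by rewrite -gE size_XnsubC // prime_gt0.
  have g0 : g != 0 by apply: contraNneq g1 => ->; apply: root0.
  by rewrite size_Mmonic ?monicXsubC // size_XsubC addn2 => -[->]; apply: prime_gt1.
have ze1 : z ^+ e = 1.
  have : root ('X^e - 1) z by rewrite gE rootM gz.
  by rewrite /root !hornerE subr_eq0 => /eqP.
have [m mz /(primeP pr_e).2/orP[] /eqP mE] := prim_order_exists (prime_gt0 pr_e) ze1.
  by move: g1; rewrite -(prim_expr_order mz) mE expr1 gz.
by exists z; rewrite -mE.
Qed.

Lemma separably_closed_three_units : exists c : K, [/\ c != 0, c != 1 & c ^+ 2 != 1].
Proof.
(* The prime 3 works outside characteristic 3, and 5 works there. *)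
have [e [pr_e e2 e0]] : exists e, [/\ prime e, (2 < e)%N & e%:R != 0 :> K].
  have [e3|] := eqVneq (3%:R : K) 0; last by exists 3%N.
  exists 5%N; split=> //; apply: contra_neq (oner_neq0 K) => e5.
  have -> : 1 = 2%:R * 3%:R - 5%:R :> K by ring.
  by rewrite e3 e5 mulr0 subrr.
have [z ze] := primitive_root_exists pr_e e0.
have [z0 zi] : z != 0 /\ forall i, (0 < i < e)%N -> z ^+ i != 1.
  split.
    have := oner_neq0 K; rewrite -(prim_expr_order ze); apply: contra_neq => ->.
    by rewrite expr0n gtn_eqF ?prime_gt0.
  move=> i /andP[i0 ie].
  by rewrite -(expr0 z) (eq_prim_root_expr ze) mod0n modn_small // -lt0n.
by exists z; split=> //; [rewrite -[z]expr1|]; apply: zi; rewrite ?(ltnW e2).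
Qed.

(** In characteristic 0 the derivative of [f] is nonzero of smaller degree, so the separable
    polynomial [f / gcd(f, f')] is not constant. *)
Lemma separably_closed_pchar0_root (f : {poly K}) : [pchar K] =i pred0 ->
  (1 < size f)%N -> exists a, root f a.
Proof.
move=> /pcharf0P ch0 f1; have f0 : f != 0 by rewrite -size_poly_gt0 ltnW.
have df0 : f^`() != 0.
  apply/eqP => /polyP/(_ (size f).-2); rewrite coef_deriv coef0 => /eqP.
  have -> : (size f).-2.+1 = (size f).-1 by case: (size f) f1 => [|[]].
  rewrite -mulr_natr mulf_eq0 ch0 -lead_coefE lead_coef_eq0 (negPf f0) /=.
  by case: (size f) f1 => [|[]].
have gf : gcdp f f^`() %| f by apply: dvdp_gcdl.
have [|a] := hK (make_separable f0).
  rewrite size_divp ?gcdp_eq0 ?negb_and ?f0 //.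
  have := dvdp_leq df0 (dvdp_gcdr f f^`()); have := lt_size_deriv f0.
  have gt0 : (0 < size (gcdp f f^`()))%N by rewrite size_poly_gt0 gcdp_eq0 negb_and f0.
  have lt n m l : (0 < l)%N -> (m < n)%N -> (l <= m)%N -> (1 < n - l.-1)%N by lia.
  by move=> dfn gdf; apply: lt gt0 dfn gdf.
by move=> ra; exists a; rewrite -(divpK gf) rootM ra.
Qed.

End SeparablyClosed.

(** * Link numbers in characteristic p and in characteristic 0 *)

Section LinkNumbers.
Variable K : fieldType.
Hypothesis hK : separably_closed K.
Implicit Types (x y z u v w P Q : golomb {poly K}) (a b d f g p q : {poly K}).
Let K3 := separably_closed_three_units hK.
Let supp_leE x y := supp_leP K3 x y.

(** Once all factors [X - a] are removed from [y], no irreducible factor can remain, so the cofactor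
    is constant. *)
Lemma supp_le_XsubC x y (a : K) : val x = 'X - a%:P -> supp_le y x ->
  exists (c : K) n, c != 0 /\ val y = c *: ('X - a%:P) ^+ n.
Proof.
move=> xE /supp_leE yx; have [n [r]] := multiplicity_XsubC (val y) a.
rewrite (valP y) /= => nra yE.
have r0 : r != 0 by apply: contraNneq nra => ->; apply: root0.
have r1 : size r = 1%N.
  apply/eqP/negPn/negP => /(irredp_factor r0)[q irr_q qr].
  have q1 : size q != 1%N by rewrite gtn_eqF //; case: irr_q.
  have := yx q irr_q; rewrite [val y]yE [val x]xE dvdp_mulr // => /(_ isT) qX.
  have /eqp_dvdl qXa := irredp_XsubC a _ q1 qX.
  by move: nra; rewrite root_factor_theorem -qXa qr.
by move/eqP: r1 => /size_poly1P[c c0 rE]; exists c, n; rewrite -mul_polyC -rE.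
Qed.

Lemma link_number_pchar (p e : nat) : p \in [pchar K] -> prime e -> e != p ->
  link_number (golomb {poly K}) e.
Proof.
move=> pK pr_e neq_ep; have pr_p := pcharf_prime pK.
have cop k : coprime (p ^ k) e.
  by apply: coprimeXl; rewrite prime_coprime // dvdn_prime2 // eq_sym.
have e0 : e%:R != 0 :> K.
  by rewrite -(dvdn_pcharf pK) dvdn_prime2 // eq_sym.
have [z ze] := primitive_root_exists hK pr_e e0.
have z0 i : z ^+ i != 0.
  apply: expf_neq0; have := oner_neq0 K; rewrite -(prim_expr_order ze).
  by apply: contra_neq => ->; rewrite expr0n gtn_eqF ?prime_gt0.
pose lin (a : K) := to_golomb (irredp_neq0 (irredp_XsubC a)).
have lin_ne (a : K) : ~ supp_empty (lin a).
  by move/(supp_emptyP K3) => /=; rewrite size_XsubC.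
exists (lin 0), (lin 1), (lin z), (unit_golomb (oner_neq0 K)).
exists (fun i => unit_golomb (z0 i)); split=> //.
- exact: (supp_atom_irredp K3 (irredp_XsubC 0)).
- exact: lin_ne.
- exact: lin_ne.
- by apply/(supp_emptyP K3); rewrite /= size_polyC oner_neq0.
split.
  move=> i j /(congr1 val) /= /polyC_inj /eqP.
  by rewrite (eq_prim_root_expr ze) !modn_small // => /eqP/val_inj.
move=> v; split=> [[/(supp_emptyP K3)/unit_golombP[c [c0 ->]] lnk]|[i <-]].
  (* Congruences modulo [X - 1] and [X - z] evaluate [y = d *: X ^+ n] at 1 and at [z], giving
     [d = 1] and [c = z ^+ n]. *)
  have cl (a b : K) (b0 : b != 0) :
      clopen_off (lin a) (cong_class (unit_golomb b0) (val (lin a) ^+ 1)).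
    apply: (clopen_off_cong K3); rewrite coprimep_sym; apply: coprimep_unit.
    by rewrite size_polyC b0.
  have [||y [/supp_leE _ y0 /= y1 yc]] := lnk _ _ (cl 1 1 (oner_neq0 K)) (cl z c c0).
  - by rewrite /cong_class /= subrr dvdp0.
  - by rewrite /cong_class /= subrr dvdp0.
  have [d [n [d0 yE]]] := @supp_le_XsubC (lin 0) y 0 erefl y0.
  move: y1 yc; rewrite /cong_class /= !expr1 yE subr0 !dvdp_XsubCl /root !hornerE.
  rewrite expr1n mulr1 !subr_eq0 => /eqP ->; rewrite mul1r => /eqP znc.
  have ne : (n %% e < e)%N by rewrite ltn_mod prime_gt0.
  by exists (Ordinal ne); apply: val_inj; rewrite /= (prim_expr_mod ze) znc.
split; first by apply/(supp_emptyP K3); rewrite /= size_polyC z0.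
move=> V W clV clW V1 Wz.
have [k sV] := cong_sub_clopen_off K3 clV V1.
have [l sW] := cong_sub_clopen_off K3 clW Wz.
(* [N] is a power of [p] above [k] and [l]; [n] is a multiple of [N], congruent to [i] modulo [e],
   and the summand [N * e] makes it positive. *)
pose N := (p ^ (k + l).+1)%N; pose n := (chinese N e 0 i + N * e)%N.
have le_N j : (j <= k + l)%N -> (j.+1 <= N)%N.
  by move=> le_j; apply: leq_trans (ltnW (ltn_expl _ (prime_gt1 pr_p))); rewrite ltnS.
have nE : z ^+ n = z ^+ i.
  rewrite exprD mulnC exprM (prim_expr_order ze) expr1n mulr1.
  by rewrite -(prim_expr_mod ze) (chinese_modr (cop _)) (prim_expr_mod ze).
have [m [m0 nM]] : exists m, (0 < m)%N /\ n = (m * N)%N.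
  have /dvdnP[r rE] : (N %| chinese N e 0 i)%N.
    by rewrite /dvdn (chinese_modl (cop _)) mod0n.
  exists (r + e)%N; split; first by rewrite addn_gt0 (prime_gt0 pr_e) orbT.
  by rewrite /n rE mulnDl [(e * N)%N]mulnC.
have n0 : (0 < n)%N by rewrite nM muln_gt0 m0 expn_gt0 prime_gt0.
have pKX : p \in [pchar {poly K}] by rewrite pchar_poly.
(* X^(mN) - c^(mN) = (X^m - c^m)^N in characteristic p *)
have dvdN (c : K) j : (j <= k + l)%N ->
    ('X - c%:P) ^+ j.+1 %| ('X - 0%:P) ^+ n - (c ^+ n)%:P.
  move=> le_j; rewrite subr0 nM !exprM rmorphXn -expr_pcharB // -/N.
  apply: dvdp_trans (dvdp_exp2l _ (le_N j le_j)) _; apply: dvdp_exp2r.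
  by rewrite dvdp_XsubCl /root !hornerE subrr.
have Xn0 : ('X - 0%:P : {poly K}) ^+ n != 0 by rewrite expf_neq0 // polyXsubC_eq0.
exists (to_golomb Xn0); split.
- by apply/supp_leE => q _ /= qX; rewrite -(prednK n0) exprS dvdp_mulr.
- apply/supp_leE => q irr_q /=; apply: contraLR => nqX.
  by rewrite -irreducible_poly_coprime // coprimep_expr // irreducible_poly_coprime.
- by apply: sV; have := dvdN 1 k (leq_addr _ _); rewrite expr1n.
- by apply: sW; rewrite /cong_class /= -nE dvdN // leq_addl.
Qed.

Lemma link_number_not_pchar (p : nat) : p \in [pchar K] ->
  ~ link_number (golomb {poly K}) p.
Proof.
move=> pK [x [P [Q [u [s [ax nP nQ]]]]]].
move=> /(supp_emptyP K3)/unit_golombP[u0 [u00 uE]] [sI sE].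
have pr_p := pcharf_prime pK.
have sC i : exists c (c0 : c != 0), s i = unit_golomb c0.
  by apply/unit_golombP/(supp_emptyP K3); case: ((sE (s i)).2 (ex_intro _ i erefl)).
have copu (T : golomb {poly K}) (c : K) (c0 : c != 0) :
    coprimep (val T) (val (unit_golomb c0)).
  by rewrite coprimep_sym coprimep_unit // size_polyC c0.
have clo (i j : 'I_p) : exists k, val u * val (s k) = val (s i) * val (s j).
  have [[c [c0 siE]] [d [d0 sjE]]] := (sC i, sC j).
  have cd0 : c * d / u0 != 0 by rewrite !mulf_neq0 ?invr_eq0.
  have [|k kE] := (sE (unit_golomb cd0)).1; last first.
    exists k; rewrite kE uE siE sjE /= -!rmorphM; congr (_%:P).
    by rewrite mulrC divfK.
  split; first by apply/(supp_emptyP K3); rewrite /= size_polyC cd0.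
  move=> V W clV clW Vu Wv.
  have [k sV] := cong_sub_clopen_off K3 clV Vu.
  have [l sW] := cong_sub_clopen_off K3 clW Wv.
  have approx m : exists y, [/\ supp_le x y, supp_le y x,
      val P ^+ k.+1 %| val y - val u & val Q ^+ l.+1 %| val y - val (s m)].
    have [_ lnk] := (sE (s m)).2 (ex_intro _ m erefl).
    have [c' [c'0 smE]] := sC m.
    have [||||y [? ? ? ?]] :=
        lnk (cong_class u (val P ^+ k.+1)) (cong_class (s m) (val Q ^+ l.+1)).
    - by apply: (clopen_off_cong K3); rewrite uE.
    - by apply: (clopen_off_cong K3); rewrite smE.
    - by rewrite /cong_class /= subrr dvdp0.
    - by rewrite /cong_class /= subrr dvdp0.
    - by exists y.
  have [y1 [xy1 /supp_leE y1x Py1 Qy1]] := approx i.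
  have [y2 [/supp_leE xy2 /supp_leE y2x Py2 Qy2]] := approx j.
  (* This product is near [u0 * u0 / u0 = u0] at [P] and near [s i * s j / u0] at [Q]. *)
  have y0 : u0^-1 *: (val y1 * val y2) != 0.
    by rewrite scaler_eq0 invr_eq0 (negPf u00) mulf_neq0 // ?(valP y1) ?(valP y2).
  have u1 : u0^-1 != 0 by rewrite invr_eq0.
  have step (T t1 t2 a b : {poly K}) : T %| t1 - a -> T %| t2 - b ->
      T %| u0^-1 *: (t1 * t2) - u0^-1 *: (a * b).
    move=> T1 T2; rewrite -scalerBr dvdpZr //.
    have -> : t1 * t2 - a * b = (t1 - a) * t2 + a * (t2 - b) by ring.
    by apply: dvdp_add; [exact: dvdp_mulr | exact: dvdp_mull].
  have scalC (c' d' : K) : u0^-1 *: (c'%:P * d'%:P) = (c' * d' / u0)%:P.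
    by rewrite -polyCM -mul_polyC -polyCM mulrC.
  exists (to_golomb y0); split.
  - by apply/supp_leE => q irr_q qx /=; rewrite dvdpZr // dvdp_mull // xy2.
  - apply/supp_leE => q irr_q /=; rewrite dvdpZr // irredp_dvdpM // => /orP[].
      exact: y1x.
    exact: y2x.
  - apply: sV; rewrite /cong_class /=; move: (step _ _ _ _ _ Py1 Py2).
    by rewrite uE /= scalC mulfK.
  - apply: sW; rewrite /cong_class /=; move: (step _ _ _ _ _ Qy1 Qy2).
    by rewrite siE sjE /= scalC.
have sN0 i : val (s i) != 0 by exact: (valP (s i)).
(* multiplication by [s i / u] permutes the image of [s] *)
have sU i : s i = u.
  have [h hE] := choice (clo i).
  have hI : injective h.
    move=> j k hjk; apply/sI/val_inj/(mulfI (sN0 i)).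
    by rewrite -!hE hjk.
  have prodE : \prod_j val (s (h j)) = \prod_j val (s j).
    by rewrite [RHS](reindex_inj hI).
  (* Cancelling the product of all [s j] leaves equal [p]-th powers of [s i] and [u], and Frobenius
     is injective. *)
  have : \prod_j (val (s i) * val (s j)) = \prod_j (val u * val (s (h j))).
    by apply: eq_bigr => j _; rewrite hE.
  rewrite !big_split /= prodE !prodr_const card_ord.
  have prod0 : \prod_j val (s j) != 0 by apply/prodf_neq0 => j _; apply: sN0.
  move=> /(mulIf prod0) eqp.
  have : (val (s i) - val u) ^+ (p ^ 1) = 0.
    by rewrite expr_pcharB ?pchar_poly // expn1 eqp subrr.
  by move=> /eqP; rewrite expf_eq0 expn_gt0 prime_gt0 //= subr_eq0 => /eqP/val_inj.
have p1 := prime_gt1 pr_p; have := sI (Ordinal p1) (Ordinal (ltnW p1)).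
by rewrite !sU => /(_ erefl) /(congr1 val).
Qed.

(** With [a] a root of [x] and [b] one of [P], any approximation is [y = d *: (X - a) ^+ n],
    [n > 0]. If it is congruent to the constant [u0] modulo [(X - b) ^+ 2], its derivative vanishes
    at [b], forcing [b = a]; but [y] is 0 at [a] and [u0] at [b]. *)
Lemma link_number_pchar0 e : [pchar K] =i pred0 -> (0 < e)%N ->
  ~ link_number (golomb {poly K}) e.
Proof.
move=> ch0 e0 [x [P [Q [u [s [[nx ax] nP nQ]]]]]].
move=> /(supp_emptyP K3)/unit_golombP[u0 [u00 uE]] [sI sE].
have root_ex y : ~ supp_empty y -> exists a : K, root (val y) a.
  move=> ny; apply: (separably_closed_pchar0_root hK ch0).
  rewrite ltn_neqAle eq_sym size_poly_gt0 (valP y) andbT.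
  by apply/eqP => /(supp_emptyP K3).
have [[a xa] [b Pb]] := (root_ex x nx, root_ex P nP).
pose X := to_golomb (irredp_neq0 (irredp_XsubC a)).
have Xx : supp_le X x.
  by apply/supp_leE => q _ /= qX; apply: dvdp_trans qX _; rewrite dvdp_XsubCl.
have xX : supp_le x X.
  by case: (ax X Xx) => // /(supp_emptyP K3); rewrite /= size_XsubC.
pose v := s (Ordinal e0).
have [ev lnk] := (sE v).2 (ex_intro _ _ erefl).
have [c [c0 vE]] : exists c (c0 : c != 0), v = unit_golomb c0.
  by apply/unit_golombP/(supp_emptyP K3).
have copu (T : golomb {poly K}) (d : K) (d0 : d != 0) :
    coprimep (val T) (val (unit_golomb d0)).
  by rewrite coprimep_sym coprimep_unit // size_polyC d0.
have [||||y [/supp_leE xy /supp_leE yx Py _]] := lnk (cong_class u (val P ^+ 2))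
    (cong_class v (val Q ^+ 1)).
- by apply: (clopen_off_cong K3); rewrite uE.
- by apply: (clopen_off_cong K3); rewrite vE.
- by rewrite /cong_class /= subrr dvdp0.
- by rewrite /cong_class /= subrr dvdp0.
have yX : supp_le y X.
  by apply/supp_leE => q irr_q qy; move/supp_leE: xX; apply=> //; apply: yx.
have [d [n [d0 yE]]] := @supp_le_XsubC X y a erefl yX.
have ya : root (val y) a.
  by rewrite root_factor_theorem xy ?dvdp_XsubCl //; apply: irredp_XsubC.
have n0 : (0 < n)%N.
  move: ya; rewrite [val y]yE; case: n {yE} => // .
  by rewrite expr0 /root !hornerE (negPf d0).
have : ('X - b%:P) ^+ 2 %| val y - u0%:P.
  move: Py; rewrite /cong_class /= uE; apply: dvdp_trans; apply: dvdp_exp2r.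
  by rewrite dvdp_XsubCl.
move=> /dvdpP[r] /eqP; rewrite subr_eq => /eqP yrE.
have yb : (val y).[b] = u0.
  by rewrite yrE expr2 !(hornerXsubC, hornerD, hornerM, hornerC) subrr; ring.
have : ((val y)^`()).[b] = 0.
  rewrite yrE expr2 derivD !derivM derivXsubC derivC.
  by rewrite !(hornerXsubC, hornerD, hornerM, hornerC) subrr; ring.
rewrite [val y]yE derivZ deriv_exp derivXsubC mul1r.
rewrite hornerZ hornerMn horner_exp hornerXsubC => /eqP.
rewrite mulf_eq0 (negPf d0) -mulr_natr mulf_eq0 ((pcharf0P K).1 ch0) eqn0Ngt n0 orbF.
rewrite expf_eq0 subr_eq0 => /andP[_ /eqP ba].
by move: ya; rewrite /root -ba yb (negPf u00).
Qed.

End LinkNumbers.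

Theorem theorem5p11 (K K' : fieldType) (p p' : nat)
    (hK : separably_closed K) (hK' : separably_closed K')
    (hp : has_characteristic K p) (hp' : has_characteristic K' p')
    (hG : homeomorphic (golomb {poly K}) (golomb {poly K'})) :
  p = p'.
Proof.
(* Every prime other than [q] is a link number over [L]. If [q'] is 0, no positive number is one
   over [L']; otherwise the prime [q'] is not. *)
have main (L L' : fieldType) (q q' : nat) : separably_closed L ->
    separably_closed L' -> has_characteristic L q -> has_characteristic L' q' ->
    homeomorphic (golomb {poly L}) (golomb {poly L'}) -> (0 < q)%N -> q = q'.
  move=> hL hL' hq hq' hLL' q0; apply/eqP/negPn/negP => neq.
  have pL : q \in [pchar L] by case: q hq q0 {neq}.
  case: q' => [|q'] in neq hq'.
    have [e [pr_e eq]] : exists e, prime e /\ e != q.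
      by have [<-|] := eqVneq 2%N q; [exists 3%N | exists 2%N].
    apply: (link_number_pchar0 hL' hq' (prime_gt0 pr_e)).
    exact: link_number_homeo hLL' (link_number_pchar hL pL pr_e eq).
  apply: (link_number_not_pchar hL' hq'); apply: link_number_homeo hLL' _.
  by apply: link_number_pchar pL _ _; rewrite ?(pcharf_prime hq') // eq_sym.
have hG' : homeomorphic (golomb {poly K'}) (golomb {poly K}).
  by case: hG => f [g [fK gK f_cont g_cont]]; exists g, f.
case: (posnP p) => [p0|]; last exact: main hG.
case: (posnP p') => [->//|p'0]; exact/esym/(main _ _ _ _ hK' hK hp' hp hG').
Qed.
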